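(* Let $G = P_m \,\square\, P_n$ be a two-dimensional grid, where $m,n \ge 1$, and let $\Sigma \subseteq E(G)$ be an arbitrary set of edges. Then there exists a signified homomorphism $h:(G,\Sigma)\to SP_9$.
   Context: A signified graph is a pair $(G,\Sigma)$ where $G$ is an undirected graph and $\Sigma\subseteq E(G)$ is the set of edges signed '$-$'; all other edges are signed '$+$'. A signified homomorphism $h:(G,\Sigma)\to(H,\Lambda)$ is a map $h:V(G)\to V(H)$ such that for every edge $\{u,v\}\in E(G)$, $\{h(u),h(v)\}$ is an edge of $H$ (in particular $h(u)\neq h(v)$) and it has the same sign in $(H,\Lambda)$ as $\{u,v\}$ has in $(G,\Sigma)$. A (2-dimensional) grid is the Cartesian product $P_m\,\square\,P_n$ of two paths. Let $\mathbb{F}_9=GF(3)[x]/(x^2+1)$ be the field with 9 elements; its nonzero squares are $1,2,x,2x$. The signified Paley graph $SP_9$ is the signified graph whose underlying graph is the complete graph $K_9$ on vertex set $\mathbb{F}_9$, where an edge $\{a,b\}$ is signed '$+$' if $b-a$ is a nonzero square in $\mathbb{F}_9$ and '$-$' otherwise (this is well defined since $-1$ is a square in $\mathbb{F}_9$). *)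

(* Defs.v *)
From HB Require Import structures.
From mathcomp Require Import all_boot all_order all_algebra all_field.

Set Implicit Arguments.
Unset Strict Implicit.
Unset Printing Implicit Defensive.

Import GRing.Theory.
Local Open Scope ring_scope.

Record sgraph := SGraph {
  vertex :> finType;
  adj : rel vertex;
  adj_sym : symmetric adj;
  adj_irrefl : irreflexive adj
}.

Definition edges (G : sgraph) : {set {set G}} :=
  [set e | [exists u : G, [exists v : G, adj u v && (e == [set u; v])]]].

Lemma set2_eqP (T : finType) (a b c d : T) :
  [set a; b] = [set c; d] -> (a = c /\ b = d) \/ (a = d /\ b = c).
Proof.
move=> E.
have := set21 a b; have := set22 a b; rewrite !{1}E !inE.
have := set21 c d; have := set22 c d; rewrite -!{1}E !inE.
by do 4![case/orP => /eqP ?]; subst; auto.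
Qed.

Lemma mem_edges (G : sgraph) (u v : G) : ([set u; v] \in edges G) = adj u v.
Proof.
rewrite inE; apply/idP/idP => [|uv].
  case/existsP=> u' /existsP[v' /andP[uv' /eqP/set2_eqP]].
  by case=> -[-> ->] //; rewrite adj_sym.
by apply/existsP; exists u; apply/existsP; exists v; rewrite uv eqxx.
Qed.

(* The edges in [neg] carry the sign '-', all the other ones the sign '+'. *)
Record signified_graph := Signified {
  underlying :> sgraph;
  neg : {set {set underlying}};
  neg_sub : neg \subset edges underlying
}.

(* [h u <> h v] is implied, since adjacency in [H] is irreflexive. *)
Definition signified_hom (G H : signified_graph) (h : G -> H) : Prop :=
  forall u v : G, adj u v ->
    adj (h u) (h v) /\ ([set h u; h v] \in neg H) = ([set u; v] \in neg G).

Section PathGraph.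
Variable n : nat.
Definition path_adj (i j : 'I_n) : bool := (i.+1 == j :> nat) || (j.+1 == i :> nat).
Lemma path_adj_sym : symmetric path_adj.
Proof. by move=> i j; rewrite /path_adj orbC. Qed.
Lemma path_adj_irrefl : irreflexive path_adj.
Proof. by move=> i; rewrite /path_adj orbb gtn_eqF. Qed.
(* [n] is the number of vertices. *)
Definition path_graph : sgraph := SGraph path_adj_sym path_adj_irrefl.
End PathGraph.

Section CartesianProduct.
Variables G H : sgraph.
Definition cart_adj (p q : G * H) : bool :=
  (p.1 == q.1) && adj p.2 q.2 || adj p.1 q.1 && (p.2 == q.2).
Lemma cart_adj_sym : symmetric cart_adj.
Proof.
by move=> p q; rewrite /cart_adj eq_sym adj_sym (adj_sym p.1) (eq_sym p.2).
Qed.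
Lemma cart_adj_irrefl : irreflexive cart_adj.
Proof. by move=> p; rewrite /cart_adj !adj_irrefl andbF. Qed.
Definition cart_prod : sgraph := SGraph cart_adj_sym cart_adj_irrefl.
End CartesianProduct.

Section CompleteGraph.
Variable T : finType.
Definition complete_adj (a b : T) : bool := a != b.
Lemma complete_adj_sym : symmetric complete_adj.
Proof. by move=> a b; rewrite /complete_adj eq_sym. Qed.
Lemma complete_adj_irrefl : irreflexive complete_adj.
Proof. by move=> a; rewrite /complete_adj eqxx. Qed.
Definition complete_graph : sgraph := SGraph complete_adj_sym complete_adj_irrefl.

(* Edges {a, b} such that [minus] holds of (a, b) or of (b, a). *)
Definition complete_neg (minus : rel T) : {set {set complete_graph}} :=
  [set e | [exists a : T, [exists b : T,
     [&& a != b, e == [set a; b] & minus a b]]]].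

Lemma complete_neg_sub (minus : rel T) :
  complete_neg minus \subset edges complete_graph.
Proof.
apply/subsetP => e; rewrite inE.
by case/existsP=> a /existsP[b /and3P[ab /eqP-> _]]; rewrite mem_edges.
Qed.

Definition signified_complete_graph (minus : rel T) : signified_graph :=
  Signified (complete_neg_sub minus).

Lemma mem_neg_complete (minus : rel T) (a b : T) : symmetric minus ->
  ([set a; b] \in neg (signified_complete_graph minus)) = (a != b) && minus a b.
Proof.
move=> symm; rewrite inE; apply/idP/idP => [|/andP[ab sab]]; last first.
  by apply/existsP; exists a; apply/existsP; exists b; rewrite ab eqxx.
case/existsP=> a' /existsP[b' /and3P[ab /eqP/set2_eqP E sab]].
by case: E => -[-> ->]; rewrite ?(eq_sym b') 1?(symm b') ab.
Qed.
End CompleteGraph.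

Definition grid (m n : nat) : sgraph := cart_prod (path_graph m) (path_graph n).

Definition polyX2D1 : {poly 'F_3} := 'X^2 + 1.

Lemma size_polyX2D1 : size polyX2D1 = 3.
Proof. by rewrite /polyX2D1 -polyC1 size_XnaddC. Qed.

Lemma polyX2D1_mi : monic_irreducible_poly polyX2D1.
Proof.
split; last by rewrite /polyX2D1 -polyC1 monicXnaddC.
apply: cubic_irreducible => [|a]; first by rewrite size_polyX2D1.
rewrite /root /polyX2D1 !hornerE.
by case: a => -[|[|[|]]].
Qed.

Notation F9 := {poly %/ polyX2D1 with polyX2D1_mi}.

Lemma card_F9 : #|{: F9}| = 9.
Proof. by rewrite card_qfpoly size_polyX2D1 card_Fp. Qed.

Definition F9X : F9 := 'qX.

Lemma F9X_sqr : F9X ^+ 2 = -1.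
Proof.
apply/eqP; rewrite -addr_eq0; apply/eqP.
have -> : F9X ^+ 2 + 1 = in_qpoly polyX2D1 polyX2D1 :> {poly %/ polyX2D1}.
  by rewrite /polyX2D1 rmorphD rmorphXn rmorph1.
apply: val_inj => /=.
by rewrite (mk_monicE polyX2D1_mi) Pdiv.RingMonic.rmodpp // polyX2D1_mi.
Qed.

Lemma F9_decomp (z : F9) : exists a b : 'F_3, z = a%:A + b *: F9X.
Proof.
have sz : (size (val z) <= 2)%N.
  by apply: leq_trans (size_npoly z) _; rewrite (mk_monicE polyX2D1_mi) size_polyX2D1.
exists (val z)`_0, (val z)`_1; apply/val_inj/polyP => i.
have valX : val F9X = 'X :> {poly 'F_3}.
  by apply: qpolyXE; [rewrite size_polyX2D1 | case: polyX2D1_mi].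
have -> : val (((val z)`_0)%:A + (val z)`_1 *: F9X : F9)
         = (val z)`_0 *: 1 + (val z)`_1 *: val F9X by [].
rewrite valX coefD !coefZ coef1 coefX.
case: i => [|[|i]] /=; rewrite ?mulr0 ?mulr1 ?add0r ?addr0 //.
by rewrite nth_default // (leq_trans sz).
Qed.

Definition nz_square (z : F9) : bool := (z != 0) && [exists y : F9, z == y ^+ 2].

Lemma nz_squareE (z : F9) : nz_square z = (z \in [:: 1; 2; F9X; 2 * F9X]).
Proof.
have F9_2 : 2 = -1 :> F9.
  have -> : 2 = (2 : 'F_3)%:A :> F9 by rewrite scaler_nat.
  have -> : 2 = -1 :> 'F_3 by apply: val_inj.
  by rewrite scaleN1r.
have X0 : F9X != 0.
  apply: contraNneq (oner_neq0 F9) => X0.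
  by rewrite -oppr_eq0 -F9X_sqr X0 expr0n.
have pX : (1 + F9X) ^+ 2 = - F9X.
  by rewrite sqrrD expr1n mul1r F9X_sqr addrAC subrr add0r -mulr_natl F9_2 mulN1r.
have mX : (1 - F9X) ^+ 2 = F9X.
  by rewrite sqrrB expr1n mul1r F9X_sqr addrAC subrr add0r -mulr_natl F9_2 mulN1r opprK.
rewrite /nz_square F9_2 mulN1r !inE; apply/andP/idP => [[z0 /existsP[y /eqP zy]]|].
  have [a [b yab]] := F9_decomp y; move: z0; rewrite {z}zy {y}yab.
  have F3P (c : 'F_3) : [\/ c = 0, c = 1 | c = -1].
    by case: c => -[|[|[|//]]] lt3; [apply: Or31|apply: Or32|apply: Or33]; apply: val_inj.
  have negE (u v : F9) : (- u + v) ^+ 2 = (u - v) ^+ 2.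
    by rewrite -sqrrN opprD opprK.
  by case: (F3P a) => ->; case: (F3P b) => ->;
    rewrite ?scale0r ?scale1r ?scaleN1r ?add0r ?addr0 ?negE ?opprK ?sqrrN
            ?expr0n ?pX ?mX ?F9X_sqr ?expr1n ?eqxx ?orbT.
by case/or4P => /eqP ->; split; rewrite ?oppr_eq0 ?oner_eq0 //; apply/existsP;
  [exists 1|exists F9X|exists (1 - F9X)|exists (1 + F9X)];
  rewrite ?expr1n ?F9X_sqr ?pX ?mX.
Qed.

Lemma nz_squareN (z : F9) : nz_square (- z) = nz_square z.
Proof.
rewrite /nz_square oppr_eq0; congr (_ && _).
by apply/existsP/existsP => -[y /eqP E]; exists (F9X * y);
  rewrite exprMn F9X_sqr mulN1r -E ?opprK.
Qed.

Definition SP9 : signified_graph :=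
  signified_complete_graph (fun a b : F9 => ~~ nz_square (b - a)).

Lemma mem_neg_SP9 (a b : F9) :
  ([set (a : SP9); (b : SP9)] \in neg SP9) = (a != b) && ~~ nz_square (b - a).
Proof.
apply: mem_neg_complete => x y.
by rewrite -nz_squareN opprB.
Qed.

(* Main.v *)
(* In coordinates over F_3, SP9 is the 3 x 3 rook's graph: the edge from [u] to
   [v] is positive iff [v - u] has exactly one zero coordinate.  The grid is
   coloured row by row; in a row, every column always keeps two available
   colours, because two distinct colours of the left neighbour, together with
   an arbitrary colour above and arbitrary signs, leave at least two choices. *)
Require Import Defs.
From mathcomp Require Import all_boot all_order all_algebra all_field.

Import GRing.Theory.
Local Open Scope ring_scope.

Definition signed_edge (s : bool) (a b : F9) : bool :=
  (a != b) && (nz_square (b - a) == s).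

(** Sign of the edge from the origin to [u]. Unlike [nz_square], which quantifies over [F9], this
    test can be evaluated by computation. *)
Definition coord_sign (s : bool) (u : 'F_3 * 'F_3) : bool :=
  ((u.1 != 0) || (u.2 != 0)) && (((u.1 == 0) (+) (u.2 == 0)) == s).

Definition coord_sub (u v : 'F_3 * 'F_3) := (u.1 - v.1, u.2 - v.2).

Definition of_coord (u : 'F_3 * 'F_3) : F9 := u.1%:A + u.2 *: F9X.

Definition F3_elems : seq 'F_3 := [:: 0; 1; -1].

Definition coords : seq ('F_3 * 'F_3) :=
  [seq (x, y) | x <- F3_elems, y <- F3_elems].

Lemma mem_coords u : u \in coords.
Proof.
by case: u => -[[|[|[|//]]] ?] [[|[|[|//]]] ?]; vm_compute.
Qed.

(** Finite check: the colour above is placed at the origin, and [b1], [b2] are the colours available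
    on the left. *)
Lemma coord_two_choices s t b1 b2 : b1 != b2 ->
  exists d : ('F_3 * 'F_3) * ('F_3 * 'F_3), [/\ d.1 != d.2,
    coord_sign s d.1, coord_sign s d.2,
    coord_sign t (coord_sub d.1 b1) || coord_sign t (coord_sub d.1 b2) &
    coord_sign t (coord_sub d.2 b1) || coord_sign t (coord_sub d.2 b2)].
Proof.
have: all (fun s => all (fun t => all (fun b1 => all (fun b2 => (b1 != b2) ==>
  has (fun d1 => has (fun d2 => [&& d1 != d2, coord_sign s d1, coord_sign s d2,
    coord_sign t (coord_sub d1 b1) || coord_sign t (coord_sub d1 b2) &
    coord_sign t (coord_sub d2 b1) || coord_sign t (coord_sub d2 b2)])
  coords) coords) coords) coords) [:: true; false]) [:: true; false].
  by vm_compute.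
have memb (b : bool) : b \in [:: true; false] by case: b.
move=> /allP/(_ s (memb s))/allP/(_ t (memb t)).
move=> /allP/(_ b1 (mem_coords b1))/allP/(_ b2 (mem_coords b2)).
move=> /implyP H /H /hasP[d1 _ /hasP[d2 _ /and5P[*]]].
by exists (d1, d2).
Qed.

Lemma of_coord_surj (z : F9) : exists u, z = of_coord u.
Proof. by have [a [b ->]] := F9_decomp z; exists (a, b). Qed.

Lemma of_coordB u v : of_coord (coord_sub u v) = of_coord u - of_coord v.
Proof. by rewrite /of_coord /= !scalerBl opprD addrACA. Qed.

(** A section [g] of the surjection [of_coord] is injective between sets of size 9, hence bijective,
    and [of_coord] is its inverse. *)
Lemma of_coord_inj : injective of_coord.
Proof.
have [g gK] := fin_all_exists of_coord_surj.
have g_bij : bijective g.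
  apply: inj_card_bij; last by rewrite card_prod card_Fp // card_F9.
  by move=> x y gxy; rewrite (gK x) (gK y) gxy.
by apply: bij_inj; apply: (bij_can_bij g_bij) => z; rewrite -gK.
Qed.

Lemma of_coord0 : of_coord 0 = 0.
Proof. by rewrite /of_coord !scale0r addr0. Qed.

Lemma of_coord_eq0 u : (of_coord u == 0) = (u == 0).
Proof. by rewrite -of_coord0 (inj_eq of_coord_inj). Qed.

(** The nonzero squares 1, 2, x, 2x are exactly the nonzero points of the two coordinate axes. *)
Lemma nz_square_coord u : nz_square (of_coord u) = ((u.1 == 0) (+) (u.2 == 0)).
Proof.
have E2 : 2 = of_coord (-1, 0).
  rewrite /of_coord scale0r addr0 /=.
  have -> : -1 = 2 :> 'F_3 by apply: val_inj.
  by rewrite scaler_nat.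
have E2X : 2 * F9X = of_coord (0, -1).
  by rewrite E2 /of_coord /= !scale0r addr0 add0r -scalerAl mul1r.
have E1 : 1 = of_coord (1, 0) by rewrite /of_coord scale0r addr0 scale1r.
have EX : F9X = of_coord (0, 1) by rewrite /of_coord scale0r add0r scale1r.
rewrite nz_squareE E2X E2 E1 {1}EX !inE !(inj_eq of_coord_inj).
by case: u => -[[|[|[|//]]] ?] [[|[|[|//]]] ?]; vm_compute.
Qed.

Lemma signed_edge_coord s u v :
  signed_edge s (of_coord u) (of_coord v) = coord_sign s (coord_sub v u).
Proof.
rewrite /signed_edge eq_sym -subr_eq0 -of_coordB of_coord_eq0 nz_square_coord.
by rewrite /coord_sign -negb_and.
Qed.

Lemma two_choices s t (c b1 b2 : F9) : b1 != b2 ->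
  exists d1 d2 : F9, [/\ d1 != d2, signed_edge s c d1, signed_edge s c d2,
    signed_edge t b1 d1 || signed_edge t b2 d1 &
    signed_edge t b1 d2 || signed_edge t b2 d2].
Proof.
(* Translations preserve signs, so [c] may be moved to the origin. *)
have shift r (x y : F9) : signed_edge r x y = signed_edge r (x - c) (y - c).
  by rewrite /signed_edge (inj_eq (addIr _)) opprB addrA subrK.
have [u1 E1] := of_coord_surj (b1 - c); have [u2 E2] := of_coord_surj (b2 - c).
move=> b12; have u12: u1 != u2.
  by apply: contraNneq b12 => u12; rewrite -(inj_eq (addIr (- c))) E1 E2 u12.
have [[d1 d2] /= [d12 s1 s2 t1 t2]] := coord_two_choices s t u1 u2 u12.
exists (of_coord d1 + c), (of_coord d2 + c).
have sub0 (d : 'F_3 * 'F_3) : coord_sub d 0 = d.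
  by case: d => x y; rewrite /coord_sub !subr0.
split; rewrite ?[signed_edge _ _ (_ + c)]shift ?addrK ?subrr ?E1 ?E2;
  rewrite -?of_coord0 ?signed_edge_coord ?sub0 //.
by rewrite (inj_eq (addIr _)) (inj_eq of_coord_inj).
Qed.

(** Available pairs propagate rightwards; actual colours are then fixed from right to left. The
    index of [c] is shifted: [c j] lies above [r j.+1]. *)
Lemma row_extension n (c : nat -> F9) (s t : nat -> bool) (b1 b2 : F9) :
  b1 != b2 -> exists2 r : nat -> F9, r 0%N \in [:: b1; b2] &
    forall j, (j < n)%N ->
      signed_edge (t j) (r j) (r j.+1) /\ signed_edge (s j) (c j) (r j.+1).
Proof.
elim: n c s t b1 b2 => [|n IHn] c s t b1 b2 b12.
  by exists (fun=> b1); rewrite ?inE ?eqxx.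
have [d1 [d2 [d12 s1 s2 t1 t2]]] := two_choices (s 0%N) (t 0%N) (c 0%N) _ _ b12.
have [r r0 rP] := IHn (c \o S) (s \o S) (t \o S) _ _ d12.
have [sr tr] : signed_edge (s 0%N) (c 0%N) (r 0%N) /\
    (signed_edge (t 0%N) b1 (r 0%N) || signed_edge (t 0%N) b2 (r 0%N)).
  by move: r0; rewrite !inE => /orP[] /eqP->.
(* Backtracking: the colour on the left is chosen once [r 0] is known. *)
have [b b_in tb] : exists2 b, b \in [:: b1; b2] & signed_edge (t 0%N) b (r 0%N).
  by case/orP: tr; [exists b1 | exists b2]; rewrite // !inE eqxx ?orbT.
by exists (fun j => if j is j'.+1 then r j' else b) => // -[|j] //; apply: rP.
Qed.

Lemma finite_dependent_choice T (R : nat -> T -> T -> Prop) (x : T) n :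
  (forall i x, exists y, R i x y) ->
  exists2 f : nat -> T, f 0%N = x & forall i, (i < n)%N -> R i (f i) (f i.+1).
Proof.
elim: n R x => [|n IHn] R x Rtot; first by exists (fun=> x).
have [y Rxy] := Rtot 0%N x.
have [f f0 fP] := IHn (fun i => R i.+1) y (fun i => Rtot i.+1).
exists (fun i => if i is i'.+1 then f i' else x) => // -[|i]; last exact: fP.
by rewrite f0.
Qed.

(* Row 0 and column 0 of [h] are virtual; they make the first row and column of
   the grid no exception. *)
Lemma grid_colouring m n (s t : nat -> nat -> bool) :
  exists h : nat -> nat -> F9, forall i j, (i < m)%N -> (j < n)%N ->
    signed_edge (t i j) (h i.+1 j) (h i.+1 j.+1) /\
    signed_edge (s i j) (h i j.+1) (h i.+1 j.+1).
Proof.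
pose R i (c r : nat -> F9) := forall j, (j < n)%N ->
  signed_edge (t i j) (r j) (r j.+1) /\ signed_edge (s i j) (c j.+1) (r j.+1).
have Rtot i c : exists r, R i c r.
  (* The virtual column 0 starts with the two distinct colours 1 and 0. *)
  have [r _ rP] := row_extension n (c \o S) (s i) (t i) _ _ (oner_neq0 F9).
  by exists r.
have [h _ hP] := finite_dependent_choice _ R (fun=> 0) m Rtot.
by exists h => i j /hP; apply.
Qed.

Lemma signed_edge_sym s : symmetric (signed_edge s).
Proof. by move=> a b; rewrite /signed_edge eq_sym -nz_squareN opprB. Qed.

Lemma signed_edge_SP9 s (a b : F9) : signed_edge s a b ->
  @adj SP9 a b /\ ([set (a : SP9); (b : SP9)] \in neg SP9) = ~~ s.
Proof. by rewrite mem_neg_SP9 => /andP[ab /eqP->]; rewrite ab. Qed.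

Theorem theorem1 (m n : nat) (hm : (1 <= m)%N) (hn : (1 <= n)%N)
    (Sigma : {set {set grid m n}}) (hSigma : Sigma \subset edges (grid m n)) :
  exists h : Signified hSigma -> SP9, signified_hom h.
Proof.
case: m n hm hn Sigma hSigma => // m [//|n] _ _ Sigma hSigma.
pose v i j : grid m.+1 n.+1 := (inord i, inord j).
have vE (p : grid m.+1 n.+1) : v p.1 p.2 = p.
  by rewrite /v !inord_val -surjective_pairing.
pose sign p q := [set p; q] \notin Sigma.
(* At index 0 the predecessor [.-1] is again 0; the resulting sign only constrains the virtual row
   or column. *)
have [h hP] := grid_colouring m.+1 n.+1
  (fun i j => sign (v i.-1 j) (v i j)) (fun i j => sign (v i j.-1) (v i j)).
pose g (p : grid m.+1 n.+1) : F9 := h p.1.+1 p.2.+1.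
have signC p q : sign p q = sign q p by rewrite /sign setUC.
suff gP p q : adj p q -> signed_edge (sign p q) (g p) (g q).
  exists g => p q /gP/signed_edge_SP9[-> ->]; split=> //; exact: negbK.
(* [hP] relates a vertex to its upper and left neighbours, so each edge is oriented towards
   increasing coordinates. *)
wlog: p q / (p.1 <= q.1)%N && (p.2 <= q.2)%N => [Hw pq|].
  have [le|] := boolP ((p.1 <= q.1)%N && (p.2 <= q.2)%N); first exact: Hw.
  move=> nle; rewrite signC signed_edge_sym; apply: Hw; last by rewrite adj_sym.
  move: pq nle; rewrite /= /cart_adj /= /path_adj.
  by case/orP=> /andP[]; [move=> /eqP-> | move=> + /eqP->];
    case/orP=> /eqP <-; rewrite leqnn leqnSn.
rewrite /= /cart_adj /= /path_adj => + /orP[]/andP[].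
- move=> le /eqP e1 /orP[]/eqP e2; last by move: le; rewrite -e2 ltnn andbF.
  have [] := hP q.1 q.2 (ltn_ord _) (ltn_ord _).
  by rewrite vE -{1 2}e2 /= -{1}e1 vE /g e1 -e2.
move=> le /orP[]/eqP e1 /eqP e2; first last.
  by move: le; rewrite -e1 ltnn.
have [_] := hP q.1 q.2 (ltn_ord _) (ltn_ord _).
by rewrite vE -{1 2}e1 /= -{1}e2 vE /g e2 -e1.
Qed.
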